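(* For every $n\ge 2$, the hypercube $Q_n$ is a square.
   Context: $Q_n$ is the graph whose vertices are the binary $n$-tuples, two being adjacent iff they differ in exactly one coordinate. All graphs are finite and simple. A partially labeled graph is a graph $H$ together with an injective map $\theta: L\to V(H)$, $L\subseteq\mathbb{N}$, whose image $\theta(L)$ is nonempty and a proper subset of $V(H)$; vertices in $\theta(L)$ are labeled. The square $HH$ is obtained from two disjoint copies of $H$ by identifying each labeled vertex $\theta(\ell)$ of the first copy with $\theta(\ell)$ of the second copy (keeping all edges, merging double edges). A graph $G$ is a square if $G\cong HH$ for some partially labeled graph $H$. *)

(* Defs.v *)
From HB Require Import structures.
From mathcomp Require Import all_boot.
From mathcomp Require Import finmap.

Set Implicit Arguments.
Unset Strict Implicit.
Unset Printing Implicit Defensive.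

Record sgraph := SGraph {
  vert :> finType;
  adj : rel vert;
  adj_sym : symmetric adj;
  adj_irr : irreflexive adj
}.

Definition graph_iso (G H : sgraph) : Prop :=
  exists2 f : G -> H, bijective f & {mono f : x y / adj x y}.

Section Hypercube.

Variable n : nat.

Definition cube_adj (x y : n.-tuple bool) : bool :=
  #|[set i : 'I_n | tnth x i != tnth y i]| == 1.

Lemma cube_adj_sym : symmetric cube_adj.
Proof.
move=> x y; rewrite /cube_adj; congr (_ == 1); apply: eq_card => i.
by rewrite !inE eq_sym.
Qed.

Lemma cube_adj_irr : irreflexive cube_adj.
Proof.
move=> x; rewrite /cube_adj (_ : [set _ | _] = set0) ?cards0 //.
by apply/setP => i; rewrite !inE eqxx.
Qed.

Definition hypercube : sgraph := SGraph cube_adj_sym cube_adj_irr.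

End Hypercube.

(* The label set is a finite set of naturals: since [lab] is injective into a
   finite vertex set, no other label set can occur. *)
Record plgraph := PLGraph {
  plg : sgraph;
  labels : {fset nat};
  lab : labels -> plg;
  lab_inj : injective lab;
  lab_nonempty : exists v : plg, v \in codom lab;
  lab_proper : exists v : plg, v \notin codom lab
}.

Section Square.

Variable H : plgraph.

Definition copies : finType := (plg H + plg H)%type.

Definition under (x : copies) : plg H :=
  match x with inl v => v | inr v => v end.

Definition copies_adj (x y : copies) : bool :=
  match x, y with
  | inl u, inl v => adj u v
  | inr u, inr v => adj u v
  | _, _ => false
  end.

Definition glue : rel copies := fun x y =>
  (x == y) ||
  [exists l : labels H, (under x == lab l) && (under y == lab l)].

Lemma glue_refl : reflexive glue.
Proof. by move=> x; rewrite /glue eqxx. Qed.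

Lemma glue_sym : symmetric glue.
Proof.
move=> x y; rewrite /glue eq_sym; congr (_ || _).
by apply: eq_existsb => l; rewrite andbC.
Qed.

Lemma glue_trans : transitive glue.
Proof.
move=> y x z /orP[/eqP-> //|/existsP[l /andP[xl yl]]].
case/orP=> [/eqP <-|/existsP[m /andP[ym zm]]]; apply/orP; right.
  by apply/existsP; exists l; rewrite xl.
by apply/existsP; exists m; rewrite (eqP xl) -(eqP yl) ym.
Qed.

Canonical glue_equiv := EquivRel glue glue_refl glue_sym glue_trans.

Definition square_quot : quotType copies := {eq_quot glue_equiv}%qT.
Definition square_vert : finType := quot_type square_quot.

Definition square_adj (a b : square_vert) : bool :=
  [exists x : copies, exists y : copies,
    [&& \pi_square_quot x == a, \pi_square_quot y == b & copies_adj x y]]%qT.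

Lemma copies_adj_sym : symmetric copies_adj.
Proof. by case=> u [] v //=; rewrite adj_sym. Qed.

Lemma glue_copies_adj x y : glue x y -> copies_adj x y = false.
Proof.
case/orP=> [/eqP<-|/existsP[l /andP[/eqP xl /eqP yl]]].
  by case: x => u /=; rewrite adj_irr.
by case: x y xl yl => u [] v //= -> ->; rewrite adj_irr.
Qed.

Lemma square_adj_sym : symmetric square_adj.
Proof.
have S a b : square_adj a b -> square_adj b a.
  case/existsP=> x /existsP[y /and3P[xa yb xy]].
  by apply/existsP; exists y; apply/existsP; exists x;
    rewrite xa yb copies_adj_sym.
by move=> a b; apply/idP/idP; apply: S.
Qed.

Lemma square_adj_irr : irreflexive square_adj.
Proof.
move=> a; apply/negbTE/negP => /existsP[x /existsP[y /and3P[/eqP xa yb]]].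
by rewrite glue_copies_adj //; apply/eqmodP; rewrite xa (eqP yb).
Qed.

Definition square : sgraph := SGraph square_adj_sym square_adj_irr.

End Square.

Definition is_square (G : sgraph) : Prop :=
  exists H : plgraph, graph_iso G (square H).

(* Main.v *)
Require Import Defs.
From mathcomp Require Import all_boot.
From mathcomp Require Import perm finmap.

Set Implicit Arguments.
Unset Strict Implicit.
Unset Printing Implicit Defensive.

(** Exchanging two coordinates [i] and [j] is an involutive automorphism of the
    cube whose fixed points are the vertices [x] with [x_i = x_j]. The vertices
    with [x_i <= x_j] and their mirror images with [x_j <= x_i] cover the cube
    and meet exactly in the fixed points. They also cover all edges: the ends of
    an edge cannot differ at both [i] and [j], so they agree at one of the two
    coordinates, and the common value there puts both ends on the same side.
    Hence the cube is obtained by gluing two copies of the half [x_i <= x_j]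
    along the fixed points. *)

Section InducedSubgraph.

Variables (G : sgraph) (P : pred G).

Definition induced_adj : rel {x : G | P x} :=
  fun x y => adj (val x) (val y).

Lemma induced_adj_sym : symmetric induced_adj.
Proof. by move=> x y; apply: adj_sym. Qed.

Lemma induced_adj_irr : irreflexive induced_adj.
Proof. by move=> x; apply: adj_irr. Qed.

Definition induced : sgraph := SGraph induced_adj_sym induced_adj_irr.

End InducedSubgraph.

Section LabelSet.

Variables (T : finType) (A : {set T}).

Definition rank_fset : {fset nat} := [fset k in iota 0 #|A|]%fset.

Lemma in_rank_fset k : (k \in rank_fset) = (k < #|A|).
Proof. by rewrite inE mem_iota. Qed.

Lemma rank_fset_lt (l : rank_fset) : fsval l < #|A|.
Proof. by rewrite -in_rank_fset fsvalP. Qed.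

Definition rank_label (l : rank_fset) : T :=
  enum_val (Ordinal (rank_fset_lt l)).

Lemma rank_label_inj : injective rank_label.
Proof. by move=> l m /enum_val_inj [lm]; apply: val_inj. Qed.

Lemma codom_rank_label : codom rank_label =i A.
Proof.
move=> x; apply/codomP/idP => [[l ->]|xA]; first exact: enum_valP.
have rank_in : val (enum_rank_in xA x) \in rank_fset.
  by rewrite in_rank_fset ltn_ord.
exists [` rank_in]%fset; rewrite -{1}(enum_rankK_in xA xA).
by congr enum_val; apply: val_inj.
Qed.

End LabelSet.

Section LabelVertices.

Variables (G : sgraph) (A : {set G}).
Hypotheses (A_neq0 : A != set0) (A_proper : A \proper [set: G]).

Lemma rank_label_nonempty : exists v : G, v \in codom (@rank_label G A).
Proof. by have /set0Pn[v vA] := A_neq0; exists v; rewrite codom_rank_label. Qed.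

Lemma rank_label_proper : exists v : G, v \notin codom (@rank_label G A).
Proof.
by have /properP[_ [v _ vA]] := A_proper; exists v; rewrite codom_rank_label.
Qed.

Definition label_vertices : plgraph :=
  PLGraph (@rank_label_inj G A) rank_label_nonempty rank_label_proper.

Lemma glue_label_vertices (x y : copies label_vertices) :
  glue x y = (x == y) || (under x \in A) && (under x == under y).
Proof.
rewrite /glue -codom_rank_label; congr (_ || _).
apply/existsP/andP => [[l /andP[/eqP-> /eqP->]]|[/codomP[l ->] /eqP <-]].
  by rewrite codom_f.
by exists l; rewrite eqxx.
Qed.

End LabelVertices.

Section SquareRecognition.

Variables (H : plgraph) (G : sgraph) (g : copies H -> G).
Hypothesis g_surj : forall a, a \in codom g.
Hypothesis g_glue : forall x y, glue x y = (g x == g y).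
Hypothesis g_adj : forall a b,
  adj a b =
  [exists x, exists y, [&& g x == a, g y == b & copies_adj x y]].

Lemma graph_iso_square : graph_iso G (square H).
Proof.
pose to_square a : square H := \pi_(square_quot H)%qT (iinv (g_surj a)).
have pi_eq x a : (\pi_(square_quot H)%qT x == to_square a) = (g x == a).
  by rewrite -[in RHS](f_iinv (g_surj a)) -g_glue; apply/eqP/idP => /eqmodP.
exists to_square.
  exists (fun q : square_quot H => g (repr q)) => [a|q]; apply/eqP.
    by rewrite -pi_eq reprK.
  by rewrite eq_sym -[X in X == _]reprK pi_eq.
move=> a b; rewrite g_adj.
by apply: eq_existsb => x; apply: eq_existsb => y; rewrite !pi_eq.
Qed.

End SquareRecognition.

Section Reflection.

Variables (G : sgraph) (phi : G -> G) (P : pred G).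
Hypothesis phiK : involutive phi.
Hypothesis phi_adj : {mono phi : x y / adj x y}.
Hypothesis P_cover : forall x, P x || P (phi x).
Hypothesis P_meet : forall x, P x -> P (phi x) -> phi x = x.
Hypothesis P_cover_adj :
  forall x y, adj x y -> P x && P y || P (phi x) && P (phi y).
Hypothesis phi_fixes : exists x, phi x = x.
Hypothesis phi_moves : exists x, phi x != x.

Definition mirror : {set induced P} := [set v | phi (val v) == val v].

Lemma mirror_neq0 : mirror != set0.
Proof.
have [x xF] := phi_fixes.
have Px : P x by have := P_cover x; rewrite xF orbb.
by apply/set0Pn; exists (Sub x Px); rewrite inE SubK xF.
Qed.

Lemma mirror_proper : mirror \proper [set: induced P].
Proof.
have [x xM] := phi_moves; rewrite properE subsetT; apply/subsetPn.
case/orP: (P_cover x) => Px; exists (Sub _ Px); rewrite ?inE ?SubK //.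
by rewrite phiK eq_sym.
Qed.

Definition half : plgraph := label_vertices mirror_neq0 mirror_proper.

Definition unfold_half (x : copies half) : G :=
  match x with inl v => val v | inr v => phi (val v) end.

Lemma unfold_half_surj a : a \in codom unfold_half.
Proof.
apply/codomP; case/orP: (P_cover a) => Pa.
  by exists (inl (Sub _ Pa)).
by exists (inr (Sub _ Pa)); rewrite /= phiK.
Qed.

Lemma val_eq_phi (u v : induced P) :
  (val u == phi (val v)) = (u \in mirror) && (u == v).
Proof.
rewrite inE; apply/eqP/andP => [uv|[/eqP + /eqP <-] //].
have vF : phi (val v) = val v.
  by apply: P_meet; [apply: valP | rewrite -uv; apply: valP].
by rewrite -val_eqE /= uv !vF.
Qed.

Lemma glue_unfold_half x y : glue x y = (unfold_half x == unfold_half y).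
Proof.
rewrite glue_label_vertices; case: x y => [u|u] [v|v] /=.
- by rewrite (inj_eq (@inl_inj _ _)) val_eqE andKb.
- by rewrite val_eq_phi.
- by rewrite (can2_eq phiK phiK) val_eq_phi.
- by rewrite (inj_eq (@inr_inj _ _)) (inj_eq (inv_inj phiK)) val_eqE andKb.
Qed.

Lemma adj_unfold_half a b :
  adj a b = [exists x, exists y,
    [&& unfold_half x == a, unfold_half y == b & copies_adj x y]].
Proof.
apply/idP/existsP => [ab|[x /existsP[y /and3P[/eqP <- /eqP <-]]]].
  case/orP: (P_cover_adj ab) => /andP[Pa Pb].
    exists (inl (Sub _ Pa)); apply/existsP; exists (inl (Sub _ Pb)).
    by rewrite /= !eqxx.
  exists (inr (Sub _ Pa)); apply/existsP; exists (inr (Sub _ Pb)).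
  by rewrite /= !phiK !eqxx /= /induced_adj phi_adj.
by case: x y => [u|u] [v|v] //=; rewrite phi_adj.
Qed.

Lemma reflection_is_square : is_square G.
Proof.
exists half; apply: (@graph_iso_square _ _ unfold_half).
- exact: unfold_half_surj.
- exact: glue_unfold_half.
- exact: adj_unfold_half.
Qed.

End Reflection.

Definition perm_tuple (T : Type) (n : nat) (s : {perm 'I_n}) (x : n.-tuple T) :
  n.-tuple T := [tuple tnth x (s i) | i < n].

Lemma cube_adj_perm (n : nat) (s : {perm 'I_n}) :
  {mono @perm_tuple bool n s : x y / cube_adj x y}.
Proof.
move=> x y; rewrite /cube_adj -[in RHS](card_preimset _ (@perm_inj _ s)).
by congr (_ == 1); apply: eq_card => i; rewrite !inE !tnth_mktuple.
Qed.

Lemma cube_adj_agree (n : nat) (x y : n.-tuple bool) (i j : 'I_n) :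
  cube_adj x y -> i != j -> (tnth x i == tnth y i) || (tnth x j == tnth y j).
Proof.
case/cards1P=> k diff_xy; apply: contraR.
rewrite negb_or => /andP[diff_i diff_j].
have: i \in [set k] by rewrite -diff_xy inE.
have: j \in [set k] by rewrite -diff_xy inE.
by rewrite !inE => /eqP-> /eqP->.
Qed.

Section SwapCoordinates.

Variables (T : eqType) (n : nat) (i j : 'I_n).

Definition swap_tuple : n.-tuple T -> n.-tuple T := perm_tuple (tperm i j).

Lemma tnth_swap_tupleL x : tnth (swap_tuple x) i = tnth x j.
Proof. by rewrite tnth_mktuple tpermL. Qed.

Lemma tnth_swap_tupleR x : tnth (swap_tuple x) j = tnth x i.
Proof. by rewrite tnth_mktuple tpermR. Qed.

Lemma swap_tupleK : involutive swap_tuple.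
Proof. by move=> x; apply: eq_from_tnth => k; rewrite !tnth_mktuple tpermK. Qed.

Lemma swap_tuple_fixE x : (swap_tuple x == x) = (tnth x i == tnth x j).
Proof.
apply/eqP/eqP => [xF|xij]; first by rewrite -[in RHS]xF tnth_swap_tupleR.
by apply: eq_from_tnth => k; rewrite tnth_mktuple; case: tpermP => // ->.
Qed.

End SwapCoordinates.

Theorem theorem5p1 (n : nat) (hn : 2 <= n) : is_square (hypercube n).
Proof.
pose i := Ordinal (ltnW hn); pose j := Ordinal hn.
pose le_ij (x : n.-tuple bool) := tnth x i ==> tnth x j.
have swap_le_ij x : le_ij (swap_tuple i j x) = (tnth x j ==> tnth x i).
  by rewrite /le_ij tnth_swap_tupleL tnth_swap_tupleR.
apply: (@reflection_is_square (hypercube n) (swap_tuple i j) le_ij).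
- exact: swap_tupleK.
- exact: cube_adj_perm.
- by move=> x; rewrite swap_le_ij /le_ij; do 2!case: (tnth x _).
- move=> x; rewrite swap_le_ij /le_ij => xij xji; apply/eqP.
  by rewrite swap_tuple_fixE; move: xij xji; do 2!case: (tnth x _).
- move=> x y /cube_adj_agree/(_ (isT : i != j)); rewrite !swap_le_ij /le_ij.
  by case/orP=> /eqP->; case: (tnth y _); rewrite ?implybT ?orbT.
- exists [tuple false | k < n]; apply/eqP.
  by rewrite swap_tuple_fixE !tnth_mktuple.
- by exists [tuple k == i | k < n]; rewrite swap_tuple_fixE !tnth_mktuple.
Qed.
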